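(* Let $L$ be a finite join-semidistributive lattice. Then $\mathrm{Dim}\,L$ is isomorphic to the commutative monoid defined by generators $\Delta(p)$, for $p\in \mathrm{J}(L)$, and relations $$\Delta(p)+\Delta(q)=\Delta(q),\quad\text{for all }p,q\in \mathrm{J}(L)\text{ such that }p\mathbin{D_L}q.$$
   Context: A lattice $L$ is join-semidistributive if $x\vee y=x\vee z$ implies $x\vee y=x\vee(y\wedge z)$ for all $x,y,z\in L$. The dimension monoid $\mathrm{Dim}\,L$ of a lattice $L$ is the commutative monoid (with zero element $0$) defined by generators $\Delta(x,y)$, for $x\le y$ in $L$, and relations: $\Delta(x,x)=0$; $\Delta(x,z)=\Delta(x,y)+\Delta(y,z)$ for $x\le y\le z$; $\Delta(x\wedge y,x)=\Delta(y,x\vee y)$, for all $x,y,z\in L$. $\mathrm{J}(L)$ is the set of join-irreducible elements of $L$, i.e., the nonzero elements $p$ such that $p=x\vee y$ implies $p=x$ or $p=y$. Join-dependency relation: for $a\in L$ and $q\in \mathrm{J}(L)$, $a\mathbin{D_L}q$ means that $a\neq q$ and there exists $x\in L$ such that $a\le q\vee x$ while $a\nleq y\vee x$ for all $y<q$. *)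

(* Defs.v *)
From HB Require Import structures.
From mathcomp Require Import all_boot all_order all_algebra.
From mathcomp Require Import boolp.

Set Implicit Arguments.
Unset Strict Implicit.
Unset Printing Implicit Defensive.

Import Order.TTheory GRing.Theory.

Local Open Scope quotient_scope.
Local Open Scope order_scope.

(* The least congruence on the free monoid seq X (concatenation is addition,
   [::] is zero) that contains rel and has a commutative quotient; that quotient
   is the commutative monoid with generators X and relations rel. *)
Inductive comm_cong (X : Type) (rel : seq X -> seq X -> Prop) :
    seq X -> seq X -> Prop :=
| comm_cong_rel s t : rel s t -> comm_cong rel s t
| comm_cong_catC s t : comm_cong rel (s ++ t) (t ++ s)
| comm_cong_cat s s' t t' : comm_cong rel s s' -> comm_cong rel t t' ->
    comm_cong rel (s ++ t) (s' ++ t')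
| comm_cong_refl s : comm_cong rel s s
| comm_cong_sym s t : comm_cong rel s t -> comm_cong rel t s
| comm_cong_trans s t u : comm_cong rel s t -> comm_cong rel t u ->
    comm_cong rel s u.

Section PresentedMonoid.
Context (X : choiceType) (rel : seq X -> seq X -> Prop).

Definition comm_congb (s t : seq X) : bool := `[< comm_cong rel s t >].

Lemma comm_congb_refl : reflexive comm_congb.
Proof. by move=> s; apply/asboolP; exact: comm_cong_refl. Qed.

Lemma comm_congb_sym : symmetric comm_congb.
Proof. by move=> s t; apply/asboolP/asboolP; exact: comm_cong_sym. Qed.

Lemma comm_congb_trans : transitive comm_congb.
Proof.
move=> t s u /asboolP st /asboolP tu; apply/asboolP.
exact: comm_cong_trans st tu.
Qed.

Canonical comm_cong_equiv :=
  EquivRel comm_congb comm_congb_refl comm_congb_sym comm_congb_trans.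

Definition presented : Type := {eq_quot comm_cong_equiv}.

HB.instance Definition _ : EqQuotient _ comm_cong_equiv presented :=
  EqQuotient.on presented.
HB.instance Definition _ := Choice.on presented.

Definition presented_word (s : seq X) : presented := \pi_presented s.
Definition presented_gen (x : X) : presented := presented_word [:: x].

Lemma presented_wordP s t :
  presented_word s = presented_word t <-> comm_cong rel s t.
Proof. by split=> [/eqquotP/asboolP|st] //; apply/eqquotP/asboolP. Qed.

Definition presented_zero : presented := presented_word [::].
Definition presented_add (a b : presented) : presented :=
  presented_word (repr a ++ repr b).

Lemma presented_word_cat s t :
  presented_add (presented_word s) (presented_word t) = presented_word (s ++ t).
Proof.
by apply/presented_wordP; apply: comm_cong_cat; apply/presented_wordP;
  exact: reprK.
Qed.

Lemma presented_wordW (P : presented -> Prop) :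
  (forall s, P (presented_word s)) -> forall a, P a.
Proof. by move=> Pword a; rewrite -[a]reprK; exact: Pword. Qed.

Lemma presented_addA : associative presented_add.
Proof.
elim/presented_wordW=> s; elim/presented_wordW=> t; elim/presented_wordW=> u.
by rewrite !presented_word_cat catA.
Qed.

Lemma presented_addC : commutative presented_add.
Proof.
elim/presented_wordW=> s; elim/presented_wordW=> t.
by rewrite !presented_word_cat; apply/presented_wordP; exact: comm_cong_catC.
Qed.

Lemma presented_add0 : left_id presented_zero presented_add.
Proof. by elim/presented_wordW=> s; rewrite presented_word_cat. Qed.

HB.instance Definition _ := GRing.isNmodule.Build presented
  presented_addA presented_addC presented_add0.

End PresentedMonoid.

Definition join_semidistributive d (L : latticeType d) : Prop :=
  forall x y z : L, x `|` y = x `|` z -> x `|` y = x `|` (y `&` z).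

Definition dim_gen d (L : latticeType d) : choiceType :=
  {xy : L * L | xy.1 <= xy.2}.

Definition Delta d (L : latticeType d) (x y : L) (le_xy : x <= y) : dim_gen L :=
  exist _ (x, y) le_xy.

Inductive dim_rel d (L : latticeType d) :
    seq (dim_gen L) -> seq (dim_gen L) -> Prop :=
| dim_rel_refl (x : L) (le_xx : x <= x) : dim_rel [:: Delta le_xx] [::]
| dim_rel_trans (x y z : L)
    (le_xy : x <= y) (le_yz : y <= z) (le_xz : x <= z) :
    dim_rel [:: Delta le_xz] [:: Delta le_xy; Delta le_yz]
| dim_rel_persp (x y : L) (le_Ix : x `&` y <= x) (le_yU : y <= x `|` y) :
    dim_rel [:: Delta le_Ix] [:: Delta le_yU].

Definition Dim d (L : latticeType d) : nmodType := presented (@dim_rel d L).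

Definition join_irreducible d (L : bLatticeType d) (p : L) : Prop :=
  p <> \bot /\ forall x y : L, p = x `|` y -> p = x \/ p = y.

Definition J d (L : bLatticeType d) : choiceType :=
  {p : L | `[< join_irreducible p >]}.

Definition join_dep d (L : bLatticeType d) (a : L) (q : J L) : Prop :=
  a <> val q /\
  exists x : L, a <= val q `|` x /\ forall y : L, y < val q -> ~ a <= y `|` x.

Inductive join_dep_rel d (L : bLatticeType d) :
    seq (J L) -> seq (J L) -> Prop :=
| join_dep_relI (p q : J L) :
    join_dep (val p) q -> join_dep_rel [:: p; q] [:: q].

Definition JDep_monoid d (L : bLatticeType d) : nmodType :=
  presented (@join_dep_rel d L).

(* Main.v *)
(* The isomorphism sends Delta(x, y) to the sum of all Delta(p) with p <= y and
   p not below x; its inverse sends Delta(p) to Delta(p_*, p), where p_* is the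
   lower cover of p.  The first map is obviously additive along chains, and it
   respects perspectivity because any join-irreducible p below x \/ y but
   below neither x nor y satisfies p D q for some q <= x, q not below y, hence
   is absorbed.  Join-semidistributivity provides, for each cover a < b, a least
   p with a \/ p = b; this p is join-irreducible, [a, b] is perspective to
   [p_*, p], and every other join-irreducible p' <= b not below a satisfies
   p' D p. *)
Require Import Defs.
From HB Require Import structures.
From mathcomp Require Import all_boot all_order all_algebra.
From mathcomp Require Import boolp.

Set Implicit Arguments.
Unset Strict Implicit.
Unset Printing Implicit Defensive.

Import Order.TTheory GRing.Theory.

Local Open Scope order_scope.

(** * Universal property of monoids given by generators and relations *)

Section PresentedLift.
Context (X : choiceType) (rel : seq X -> seq X -> Prop) (M : nmodType).
Context (g : X -> M).
Hypothesis grel : forall s t, rel s t ->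
  (\sum_(x <- s) g x = \sum_(x <- t) g x)%R.

Lemma comm_cong_sum s t : comm_cong rel s t ->
  (\sum_(x <- s) g x = \sum_(x <- t) g x)%R.
Proof.
elim=> {s t} [s t /grel //|s t|s s' t t' _ Es _ Et|//|s t _ ->//|s t u _ -> _ ->//].
  by rewrite !big_cat /= addrC.
by rewrite !big_cat /= Es Et.
Qed.

(* The unused dependency on grel lets the additive structure be inferred. *)
#[using="grel"] Definition presented_lift (a : presented rel) : M :=
  (\sum_(x <- repr a) g x)%R.

Lemma presented_lift_word s :
  presented_lift (presented_word rel s) = (\sum_(x <- s) g x)%R.
Proof. by apply: comm_cong_sum; apply/presented_wordP; exact: reprK. Qed.

Lemma presented_lift_gen x : presented_lift (presented_gen rel x) = g x.
Proof. by rewrite presented_lift_word big_seq1. Qed.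

Lemma presented_lift_is_additive : nmod_morphism presented_lift.
Proof.
split=> [|]; first by rewrite presented_lift_word big_nil.
elim/presented_wordW=> s; elim/presented_wordW=> t.
by rewrite [X in presented_lift X]presented_word_cat !presented_lift_word big_cat.
Qed.

HB.instance Definition _ := GRing.isNmodMorphism.Build (presented rel) M
  presented_lift presented_lift_is_additive.

End PresentedLift.

Lemma presented_word_sum (X : choiceType) (rel : seq X -> seq X -> Prop) s :
  presented_word rel s = (\sum_(x <- s) presented_gen rel x)%R.
Proof.
elim: s => [|x s IHs]; first by rewrite big_nil.
by rewrite big_cons -IHs [RHS]presented_word_cat.
Qed.

Lemma sum_absorb (I : finType) (M : nmodType) (F : I -> M) (A B : pred I) :
  subpred A B ->
  (forall p, B p -> ~~ A p -> exists2 q, A q & (F p + F q = F q)%R) ->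
  (\sum_(p | B p) F p = \sum_(p | A p) F p)%R.
Proof.
move=> sAB absorb; rewrite (bigID A) /=.
have eqA : (fun p => B p && A p) =1 A.
  by move=> p; case: (boolP (A p)) => [/sAB ->|_]; rewrite ?andbF.
rewrite (eq_bigl _ _ eqA).
rewrite addrC; set S := (\sum_(p | A p) F p)%R.
(* The elements absorbed by [S] are closed under addition, so absorbing each term of [B] outside [A]
   is enough. *)
apply: (big_ind (fun c => c + S = S)%R) => [|c c' cS c'S|p /andP[Bp nAp]].
- by rewrite add0r.
- by rewrite -addrA c'S cS.
have [q Aq Fpq] := absorb p Bp nAp.
by rewrite /S (bigD1 q) //= addrA Fpq.
Qed.

Lemma exists_minimal d (T : finPOrderType d) (P : pred T) (x0 : T) :
  P x0 -> exists2 x, P x & forall y, y < x -> ~~ P y.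
Proof.
move=> Px0; have [x Px xmin] := arg_minnP (fun x => #|[pred z | z <= x]|) Px0.
exists x => // y lt_yx; apply/negP => /xmin; rewrite leqNgt => /negP[].
apply: proper_card; apply/properP; split.
  by apply/subsetP => z; rewrite !inE => /le_trans -> //; exact: ltW.
by exists x; rewrite !inE ?lexx // lt_geF.
Qed.

Lemma exists_maximal d (T : finPOrderType d) (P : pred T) (x0 : T) :
  P x0 -> exists2 x, P x & forall y, x < y -> ~~ P y.
Proof. exact: (@exists_minimal _ T^d). Qed.

(** * Join-irreducible elements and join-dependency *)

Section FiniteLattice.
Context (d : Order.disp_t) (L : finTBLatticeType d).
Implicit Types (x y z a b p : L).

Definition Jfin : finType := {p : L | `[< join_irreducible p >]}.

(** For join-irreducible [p] this is the unique lower cover p_*; for every other [p] it is [p]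
    itself. *)
Definition lower_cover p : L := \join_(y | y < p) y.

Lemma le_lower_cover p y : y < p -> y <= lower_cover p.
Proof. by move=> lt_yp; exact: (@joins_sup _ _ _ y). Qed.

Lemma lower_cover_lt (p : J L) : lower_cover (val p) < val p.
Proof.
case: p => p /= /asboolP[p_neq0 pU].
apply: (big_ind (fun y => y < p)) => // [|x y lt_xp lt_yp].
  by rewrite lt0x; apply/eqP.
rewrite lt_neqAle leUx (ltW lt_xp) (ltW lt_yp) !andbT.
by apply/eqP => /esym/pU[] E; [move: lt_xp | move: lt_yp]; rewrite -E ltxx.
Qed.

Lemma le_lower_coverE (p : J L) y : y <= val p -> ~~ (val p <= y) ->
  y <= lower_cover (val p).
Proof.
move=> le_yp nle_py; apply: le_lower_cover.
by rewrite lt_neqAle le_yp andbT; apply: contra nle_py => /eqP->.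
Qed.

(** If [p] were the join of two smaller elements, both would lie below [x], and so would [p]. *)
Lemma minimal_join_irreducible x p : ~~ (p <= x) ->
  (forall y, y < p -> y <= x) -> join_irreducible p.
Proof.
move=> nle_px pmin; split=> [p0|a b Ep]; first by rewrite p0 le0x in nle_px.
have [le_ap le_bp] : a <= p /\ b <= p by rewrite Ep leUl leUr.
case: (eqVneq p a) => [|neq_pa]; first by left.
case: (eqVneq p b) => [|neq_pb]; first by right.
case/negP: nle_px; rewrite Ep leUx !pmin // lt_neqAle eq_sym.
  by rewrite neq_pb.
by rewrite neq_pa.
Qed.

(** Take [w <= x] maximal with [p] not below w \/ y, then [q <= x] minimal not below [w]. Maximality
    of [w] puts [p] below q \/ w \/ y, while every [z < q] lies below [w]; so w \/ y witnesses the
    dependency. *)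
Lemma join_cover_dep x y (p : J L) :
  val p <= x `|` y -> ~~ (val p <= x) -> ~~ (val p <= y) ->
  exists2 q : J L, (val q <= x) && ~~ (val q <= y) & join_dep (val p) q.
Proof.
move=> le_pxy nle_px nle_py.
have P0 : ((\bot : L) <= x) && ~~ (val p <= \bot `|` y) by rewrite le0x join0x.
have [w /andP[le_wx nle_pwy] wmax] := exists_maximal
  (P := fun w => (w <= x) && ~~ (val p <= w `|` y)) P0.
have nle_xw : ~~ (x <= w).
  by apply: contra nle_pwy => le_xw; apply: le_trans le_pxy _; rewrite leU2.
have Qx : (x <= x) && ~~ (x <= w) by rewrite lexx.
have [q /andP[le_qx nle_qw] qmin] :=
  exists_minimal (P := fun q : L => (q <= x) && ~~ (q <= w)) Qx.
have le_ltq z : z < q -> z <= w.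
  move=> lt_zq; move: (qmin _ lt_zq); rewrite negb_and negbK.
  by rewrite (le_trans (ltW lt_zq) le_qx).
have qJ : `[< join_irreducible q >].
  by apply/asboolP; exact: minimal_join_irreducible nle_qw le_ltq.
have le_pqwy : val p <= q `|` (w `|` y).
  have lt_w : w < q `|` w.
    rewrite lt_neqAle leUr andbT.
    by apply: contra nle_qw => /eqP->; exact: leUl.
  move: (wmax _ lt_w); rewrite negb_and negbK leUx le_qx le_wx /=.
  by rewrite joinA.
exists (exist _ q qJ) => /=; last split=> /=.
- rewrite le_qx; apply: contra nle_pwy => le_qy.
  by apply: le_trans le_pqwy _; rewrite leUx lexx andbT lexU2 // le_qy orbT.
- by move=> Epq; move: nle_px; rewrite [val p]Epq le_qx.
- exists (w `|` y); split=> // z /le_ltq le_zw; apply/negP.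
  by rewrite joinA (join_idPr le_zw).
Qed.

(** * Intervals as elements of the dimension monoid *)

(** The default 0 for pairs outside the order makes this total, so endpoints can be rewritten
    without transporting a proof of [x <= y]. *)
Definition delta x y : Dim L :=
  if insub (x, y) is Some u then presented_gen (@dim_rel d L) u else 0%R.

Lemma deltaE x y (le_xy : x <= y) :
  delta x y = presented_gen (@dim_rel d L) (Delta le_xy).
Proof. by rewrite /delta insubT. Qed.

Lemma delta_val (u : dim_gen L) :
  delta (val u).1 (val u).2 = presented_gen (@dim_rel d L) u.
Proof. by rewrite /delta -surjective_pairing valK. Qed.

Lemma deltaxx x : delta x x = 0%R.
Proof.
rewrite (deltaE (lexx x)); apply/presented_wordP.
by apply: comm_cong_rel; exact: dim_rel_refl.
Qed.

Lemma delta_trans x y z : x <= y -> y <= z ->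
  delta x z = (delta x y + delta y z)%R.
Proof.
move=> le_xy le_yz; have le_xz := le_trans le_xy le_yz.
rewrite (deltaE le_xy) (deltaE le_yz) (deltaE le_xz).
rewrite [RHS]presented_word_cat; apply/presented_wordP.
by apply: comm_cong_rel; exact: dim_rel_trans.
Qed.

Lemma delta_persp x y : delta (x `&` y) x = delta y (x `|` y).
Proof.
rewrite (deltaE (leIl x y)) (deltaE (leUr y x)); apply/presented_wordP.
by apply: comm_cong_rel; exact: dim_rel_persp.
Qed.

Definition delta_ji (p : L) : Dim L := delta (lower_cover p) p.

(** The hypotheses give q /\ x = q_*, so the two intervals are perspective. *)
Lemma delta_ji_up (q : J L) x : lower_cover (val q) <= x -> ~~ (val q <= x) ->
  delta_ji (val q) = delta x (val q `|` x).
Proof.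
move=> le_qx nle_qx; rewrite -delta_persp; congr (delta _ _).
apply/le_anti; rewrite lexI le_qx (ltW (lower_cover_lt q)) /=.
by apply: le_lower_coverE; rewrite ?leIl // lexI lexx.
Qed.

Hypothesis hL : join_semidistributive L.

(** This makes the map Delta(p) |-> Delta(p_*, p) well defined. For a witness [x] above q_*, the
    interval [x, q \/ x] represents Delta(q) and contains [x, p \/ x], hence has Delta(p) as a
    summand; the case analysis turns this into absorption. *)
Lemma delta_ji_absorb (p q : J L) : join_dep (val p) q ->
  (delta_ji (val p) + delta_ji (val q) = delta_ji (val q))%R.
Proof.
case=> neq_pq [x0 [le_px0 nle_px0]].
(* x \/ q_* can be joined with p_* unless this would put p below it. *)
have [x [le_px nle_px le_qx px]] : exists x, [/\ val p <= val q `|` x,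
    ~~ (val p <= x), lower_cover (val q) <= x &
    lower_cover (val p) <= x \/ val p <= lower_cover (val p) `|` x].
  set x := lower_cover (val q) `|` x0.
  have nle_px : ~~ (val p <= x) by apply/negP; exact/nle_px0/lower_cover_lt.
  have le_px : val p <= val q `|` x by rewrite (le_trans le_px0) // leU2 // leUr.
  have [le_pU|nle_pU] := boolP (val p <= lower_cover (val p) `|` x).
    by exists x; split; rewrite ?leUl //; right.
  exists (lower_cover (val p) `|` x); split=> //; last by left; exact: leUl.
    by rewrite (le_trans le_px) // leU2 // leUr.
  by rewrite joinCA leUl.
move: x0 le_px0 nle_px0 => _ _ _.
have nle_qx : ~~ (val q <= x).
  by apply: contra nle_px => /join_idPr <-.
have Eq := delta_ji_up le_qx nle_qx.
have lt_p := lower_cover_lt p.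
(* [c] measures the part of [p /\ x, p] below p_*. *)
set c := delta (val p `&` x) (lower_cover (val p)).
have le_Ip : val p `&` x <= lower_cover (val p).
  by apply: le_lower_coverE; rewrite ?leIl // lexI lexx.
have Epx : delta x (val p `|` x) = (c + delta_ji (val p))%R.
  by rewrite -delta_persp (delta_trans le_Ip (ltW lt_p)).
(* If p <= p_* \/ x, then [x, x \/ p] is also perspective to [p /\ x, p_*]. *)
have c_absorb : val p <= lower_cover (val p) `|` x -> (c + delta_ji (val p))%R = c.
  move=> le_pU; rewrite -Epx.
  have -> : val p `|` x = lower_cover (val p) `|` x.
    by apply/le_anti; rewrite !leUx le_pU !leUr lexUl ?(ltW lt_p).
  rewrite -delta_persp; congr (delta _ _); apply/le_anti.
  by rewrite leI2 ?(ltW lt_p) // lexI le_Ip leIr.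
have [le_qp|nle_qpx] := boolP (val q <= val p `|` x).
- (* Then q \/ x = p \/ x, and join-semidistributivity forces q < p. *)
  have EU : x `|` val q = x `|` val p.
    apply/le_anti; rewrite !leUx !leUl /= [x `|` val p]joinC le_qp.
    by rewrite joinC le_px.
  have lt_qp : val q < val p.
    rewrite lt_neqAle; apply/andP; split; first by apply/eqP => /esym.
    apply: contraR nle_qx => nle_qp.
    have : val q <= x `|` val q by exact: leUr.
    rewrite (hL EU) => /le_trans-> //; rewrite leUx lexx /=.
    apply: le_trans le_qx; apply: le_lower_coverE; rewrite ?leIl //.
    by rewrite lexI lexx.
  have le_pU : val p <= lower_cover (val p) `|` x.
    by apply: le_trans le_px _; rewrite leU2 // le_lower_cover.
  have -> : delta_ji (val q) = c.
    by rewrite Eq [val q `|` x]joinC EU joinC Epx c_absorb.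
  by rewrite addrC c_absorb.
(* Split [x, q \/ x] at p \/ x: the upper piece is again perspective to [q_*, q], as [q] is not
   below p \/ x. *)
have Eq' : delta_ji (val q) = (c + delta_ji (val p) + delta_ji (val q))%R.
  rewrite -Epx {1}Eq (@delta_trans _ (val p `|` x)) ?leUr //; last first.
    by rewrite leUx le_px leUr.
  congr (_ + _)%R; rewrite (delta_ji_up _ nle_qpx); last first.
    by rewrite (le_trans le_qx) // leUr.
  congr delta; apply/le_anti.
  by rewrite !leUx !leUl le_px leUr /= andbT (le_trans _ (leUr _ _)) // leUr.
(* Either [c] vanishes, or [c] absorbs Delta(p) and is itself absorbed by Delta(q). *)
case: px => [le_px'|/c_absorb cp]; last first.
  by rewrite {1}Eq' cp addrA [(_ + c)%R]addrC cp [RHS]Eq' cp.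
have c0 : c = 0%R.
  rewrite /c -[RHS](deltaxx (lower_cover (val p))); congr delta; apply/le_anti.
  by rewrite le_Ip lexI le_px' (ltW lt_p).
by rewrite [RHS]Eq' c0 add0r.
Qed.

(** * Sums over the join-irreducibles between two elements *)

Definition gen_ji (p : J L) : JDep_monoid L :=
  presented_gen (@join_dep_rel d L) p.

Lemma gen_ji_absorb (p q : J L) : join_dep (val p) q ->
  (gen_ji p + gen_ji q = gen_ji q)%R.
Proof.
move=> pDq; rewrite [LHS]presented_word_cat; apply/presented_wordP.
by apply: comm_cong_rel; exact: join_dep_relI.
Qed.

Definition ji_between x y : pred Jfin :=
  fun p : Jfin => (val p <= y) && ~~ (val p <= x).

(** The monoid is a parameter because these sums are needed both in [JDep_monoid L] and in
    [Dim L]. *)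
Definition ji_sum (M : nmodType) (F : J L -> M) x y : M :=
  (\sum_(p : Jfin | ji_between x y p) F p)%R.

Lemma ji_sum_trans (M : nmodType) (F : J L -> M) x y z : x <= y -> y <= z ->
  ji_sum F x z = (ji_sum F x y + ji_sum F y z)%R.
Proof.
move=> le_xy le_yz; rewrite /ji_sum (bigID (fun p : Jfin => val p <= y)) /=.
congr (_ + _)%R; apply: eq_bigl => p; rewrite /ji_between.
  have [le_py|] := boolP (val p <= y); last by rewrite andbF.
  by rewrite (le_trans le_py le_yz) andbT.
have [le_py|nle_py] := boolP (val p <= y); first by rewrite !andbF.
by rewrite !andbT (contra _ nle_py) ?andbT // => /le_trans->.
Qed.

Lemma ji_sum_refl (M : nmodType) (F : J L -> M) x : ji_sum F x x = 0%R.
Proof. by rewrite /ji_sum big_pred0 // => p; rewrite /ji_between andbN. Qed.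

Lemma ji_sum_persp x y :
  ji_sum gen_ji (x `&` y) x = ji_sum gen_ji y (x `|` y).
Proof.
apply/esym/sum_absorb => p; rewrite /ji_between lexI.
  by case/andP=> le_px; rewrite le_px /= => ->; rewrite lexUl.
case/andP=> le_pU nle_py; rewrite (negPf nle_py) andbF andbT => nle_px.
have [q /andP[le_qx nle_qy] pDq] := join_cover_dep le_pU nle_px nle_py.
by exists q; [rewrite lexI le_qx | exact: gen_ji_absorb].
Qed.

Lemma ji_sum_lower_cover (M : nmodType) (F : J L -> M) (p : J L) :
  ji_sum F (lower_cover (val p)) (val p) = F p.
Proof.
rewrite /ji_sum (big_pred1 (p : Jfin)) // => q; rewrite /ji_between /=.
apply/andP/eqP => [[le_qp nle_q]|->].
  apply/val_inj/eqP; apply: contraR nle_q => neq_qp.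
  by apply: le_lower_cover; rewrite lt_neqAle neq_qp.
by rewrite lexx lt_geF ?lower_cover_lt.
Qed.

(** By [hL] the solutions [y] of a \/ y = b are closed under meet, so a minimal one is least. *)
Lemma least_cover_joinand a b : a < b ->
  exists2 p, a `|` p = b & forall y, a `|` y = b -> p <= y.
Proof.
move=> lt_ab; have /eqP Eb : a `|` b == b by rewrite (join_idPr (ltW lt_ab)).
have [p /eqP Ep pmin] := exists_minimal (P := fun p => a `|` p == b) (introT eqP Eb).
exists p => // y Ey; apply: contraT => nle_py.
have /pmin/negP[] : p `&` y < p by rewrite lt_neqAle leIl andbT -leEmeet.
by apply/eqP; rewrite -(hL (x := a)) ?Ep ?Ey.
Qed.

Lemma delta_cover a b : a < b -> (forall z, a < z -> z < b -> False) ->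
  delta a b = ji_sum (delta_ji \o val) a b.
Proof.
move=> lt_ab cover_ab; have [p0 Ep0 p0min] := least_cover_joinand lt_ab.
have nle_p0a : ~~ (p0 <= a).
  by apply/negP => /join_idPl E; move: lt_ab; rewrite -Ep0 E ltxx.
have joinE z : z <= b -> ~~ (z <= a) -> a `|` z = b.
  move=> le_zb nle_za; apply/eqP; apply: contraT => neq_zb.
  case: (cover_ab (a `|` z)); last by rewrite lt_neqAle neq_zb leUx ltW.
  rewrite lt_neqAle leUl andbT; apply: contra nle_za => /eqP->.
  exact: leUr.
have le_p0b : p0 <= b by rewrite -Ep0 leUr.
have p0lt z : z < p0 -> z <= a.
  move=> lt_zp0; apply: contraT => nle_za; move: (lt_geF lt_zp0).
  by rewrite p0min // joinE // (le_trans (ltW lt_zp0)).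
have p0J : `[< join_irreducible p0 >].
  by apply/asboolP; exact: minimal_join_irreducible nle_p0a p0lt.
pose p : J L := exist _ p0 p0J.
rewrite /ji_sum (sum_absorb (A := pred1 (p : Jfin))) => [|_ /eqP->|q].
- rewrite big_pred1_eq /= (@delta_ji_up p a) //=; first by rewrite joinC Ep0.
  exact/p0lt/(lower_cover_lt p).
- by rewrite /ji_between /= le_p0b.
case/andP=> le_qb nle_qa /= neq_qp; exists p => //=.
apply: (@delta_ji_absorb q p); split=> [Eq|].
  by move/eqP: neq_qp; apply; exact: val_inj.
(* [a] witnesses the dependency, since everything strictly below [p0] lies below [a]. *)
exists a; split=> /= [|y /p0lt/join_idPr->]; first by rewrite joinC Ep0.
exact/negP.
Qed.

(** Induction on the number of elements above [x], splitting [x, y] at a cover [z] of [x]; both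
    sides are additive along chains. *)
Lemma delta_ji_sum x y : x <= y -> delta x y = ji_sum (delta_ji \o val) x y.
Proof.
have [n] := ubnP #|[pred z | x <= z]|; elim: n x => // n IHn x le_n le_xy.
move: le_xy; rewrite le_eqVlt => /predU1P[<-|lt_xy].
  by rewrite deltaxx ji_sum_refl.
have Py : (x < y) && (y <= y) by rewrite lt_xy lexx.
have [z /andP[lt_xz le_zy] zmin] :=
  exists_minimal (P := fun z => (x < z) && (z <= y)) Py.
rewrite (delta_trans (ltW lt_xz) le_zy) (ji_sum_trans _ (ltW lt_xz) le_zy).
congr (_ + _)%R.
  apply: delta_cover => // t lt_xt lt_tz; move: (zmin t lt_tz).
  by rewrite lt_xt (le_trans (ltW lt_tz)).
rewrite ltnS in le_n; apply: IHn => //; apply: leq_trans le_n; apply: proper_card.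
apply/properP; split; last by exists x; rewrite !inE ?lexx // lt_geF.
by apply/subsetP => t; rewrite !inE; exact/le_trans/ltW.
Qed.

(** * The two mutually inverse homomorphisms *)

Definition dim_gen_sum (u : dim_gen L) : JDep_monoid L :=
  ji_sum gen_ji (val u).1 (val u).2.

Lemma dim_gen_sum_rel s t : dim_rel s t ->
  (\sum_(u <- s) dim_gen_sum u = \sum_(u <- t) dim_gen_sum u)%R.
Proof.
case=> [x le_xx|x y z le_xy le_yz le_xz|x y le_Ix le_yU].
- by rewrite big_seq1 big_nil /dim_gen_sum ji_sum_refl.
- by rewrite big_seq1 big_cons big_seq1 /dim_gen_sum (ji_sum_trans _ le_xy le_yz).
- by rewrite !big_seq1 /dim_gen_sum ji_sum_persp.
Qed.

Lemma delta_ji_rel s t : join_dep_rel s t ->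
  (\sum_(p <- s) delta_ji (val p) = \sum_(p <- t) delta_ji (val p))%R.
Proof.
by case=> p q pDq; rewrite big_cons !big_seq1; exact: delta_ji_absorb.
Qed.

Definition dim_to_ji : {additive Dim L -> JDep_monoid L} :=
  presented_lift dim_gen_sum_rel.

Definition ji_to_dim : {additive JDep_monoid L -> Dim L} :=
  presented_lift delta_ji_rel.

Lemma dim_to_jiK : cancel dim_to_ji ji_to_dim.
Proof.
elim/presented_wordW=> s; rewrite presented_word_sum.
rewrite (raddf_sum dim_to_ji) (raddf_sum ji_to_dim).
apply: eq_bigr => u _.
rewrite [dim_to_ji _]presented_lift_gen (raddf_sum ji_to_dim).
rewrite -delta_val delta_ji_sum ?(valP u) //.
by apply: eq_bigr => p _; rewrite [LHS]presented_lift_gen.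
Qed.

Lemma ji_to_dimK : cancel ji_to_dim dim_to_ji.
Proof.
elim/presented_wordW=> s; rewrite presented_word_sum.
rewrite (raddf_sum ji_to_dim) (raddf_sum dim_to_ji).
apply: eq_bigr => p _; rewrite [ji_to_dim _]presented_lift_gen.
rewrite /delta_ji (deltaE (ltW (lower_cover_lt p))) [LHS]presented_lift_gen.
exact: ji_sum_lower_cover.
Qed.

End FiniteLattice.

Theorem theorem1 (d : Order.disp_t) (L : finTBLatticeType d)
    (hL : join_semidistributive L) :
  exists f : {additive Dim L -> JDep_monoid L}, bijective f.
Proof.
by exists (dim_to_ji L); exists (ji_to_dim hL);
  [exact: dim_to_jiK | exact: ji_to_dimK].
Qed.
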